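(* Let $G$ be a connected graph with $n$ vertices, independence number $\alpha(G)$ and diameter $d(G)\leq 2$. Then $$m_{D^{L}(G)}(2n-1,2n)=\alpha(G)-1=\frac{n}{2}-1$$ if and only if $G$ is (isomorphic to) the corona $H\circ K_1$ for some connected graph $H$.
   Context: All graphs are finite, simple and connected. The corona $H\circ K_1$ of a graph $H$ is obtained from $H$ by attaching to each vertex $v$ of $H$ one new vertex adjacent only to $v$. For a connected graph $G$ with vertex set $\{v_1,\dots,v_n\}$, $d_{uv}$ is the length of a shortest path between $u$ and $v$, the diameter is the maximum of the $d_{uv}$, $D(G)=(d_{uv})$ is the distance matrix, $Tr(v)=\sum_{u\in V(G)}d_{uv}$ is the transmission of $v$, and the distance Laplacian matrix is $D^L(G)=\mathrm{diag}(Tr(v_1),\dots,Tr(v_n))-D(G)$. Its eigenvalues (all real) are the distance Laplacian eigenvalues of $G$. For an interval $I\subseteq\mathbb{R}$, $m_{D^L(G)}I$ denotes the number of distance Laplacian eigenvalues of $G$, counted with multiplicity, lying in $I$. *)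

(* Defs.v *)
From mathcomp Require Import all_boot all_order all_algebra.
From mathcomp Require Import polyrcf.

Set Implicit Arguments.
Unset Strict Implicit.
Unset Printing Implicit Defensive.

Import Order.TTheory GRing.Theory Num.Theory.

Record sgraph := SGraph {
  vertex :> finType;
  adj : rel vertex;
  adj_sym : symmetric adj;
  adj_irr : irreflexive adj
}.

Definition connected_graph (G : sgraph) : Prop :=
  (0 < #|G|)%N /\ forall u v : G, connect (@adj G) u v.

Definition graph_iso (G H : sgraph) : Prop :=
  exists f : G -> H, bijective f /\ forall u v, adj (f u) (f v) = adj u v.

(* [inl v] is the copy of the vertex [v] of H, and [inr v] is the new vertex
   attached to it. *)
Definition corona_rel (H : sgraph) : rel (H + H)%type := fun a b =>
  match a, b with
  | inl u, inl v => adj u v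
  | inl u, inr v | inr u, inl v => u == v
  | inr _, inr _ => false
  end.

Lemma corona_sym (H : sgraph) : symmetric (@corona_rel H).
Proof. by case=> u [] v //=; rewrite ?[u == v]eq_sym // adj_sym. Qed.

Lemma corona_irr (H : sgraph) : irreflexive (@corona_rel H).
Proof. by case=> u //=; rewrite adj_irr. Qed.

Definition corona_K1 (H : sgraph) : sgraph :=
  SGraph (@corona_sym H) (@corona_irr H).

Definition independent (G : sgraph) (S : {set G}) : bool :=
  [forall u in S, forall v in S, ~~ adj u v].

Definition independence_number (G : sgraph) : nat :=
  \max_(S : {set G} | independent S) #|S|.

Definition has_path (G : sgraph) (u v : G) (k : nat) : bool :=
  [exists p : k.-tuple G,
    [&& path (@adj G) u p, uniq (u :: p) & last u p == v]].

(* A path has fewer than #|G| edges, so when u and v are connected this is the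
   length of a shortest path; otherwise it takes the junk value #|G|. *)
Definition dist (G : sgraph) (u v : G) : nat :=
  \big[minn/#|G|]_(k < #|G| | has_path u v k) k.

Definition diameter (G : sgraph) : nat := \max_(u : G) \max_(v : G) dist u v.

Definition transmission (G : sgraph) (v : G) : nat := \sum_(u : G) dist u v.

Local Open Scope ring_scope.

Definition dist_mx (R : rcfType) (G : sgraph) : 'M[R]_#|G| :=
  \matrix_(i, j) (dist (enum_val i) (enum_val j))%:R.

Definition dist_laplacian (R : rcfType) (G : sgraph) : 'M[R]_#|G| :=
  diag_mx (\row_i (transmission (enum_val i))%:R) - dist_mx R G.

(* [rootsR] lists each root in R once. *)
Definition eigenvalue_count (R : rcfType) (n : nat) (M : 'M[R]_n)
    (I : interval R) : nat :=
  (\sum_(x <- rootsR (char_poly M) | x \in I) mup x (char_poly M))%N.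

(* Main.v *)
(* In diameter at most 2 the distance Laplacian is [2n I - 2J - L] with [L] the
   Laplacian and [J] the all-ones matrix, so the eigenvalues in (2n-1, 2n) are
   the [2n - mu] for the Laplacian eigenvalues [mu] in (0, 1); together with the
   all-ones vector, their eigenvectors span a space of dimension [m + 1] whose
   nonzero vectors have energy less than their squared norm.  A vector vanishing
   on a dominating set [S] has energy at least its squared norm, hence
   [m + 1 <= #|S|].  Neighbourhoods are dominating in diameter 2; so if
   [m + 1 = alpha = n / 2], each vertex of a maximum independent set [A] has at
   least [n / 2] neighbours, that is, is adjacent to all of [~: A].  A spanning
   complete balanced bipartite subgraph forces [m = 0], so [n = 2].  Conversely,
   in a corona of diameter at most 2 the base graph has a single vertex, since
   two pendant vertices have no common neighbour. *)
Require Import Defs.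
From mathcomp Require Import all_boot all_order all_algebra reals.
From mathcomp Require Import polyrcf ring lra zify.

Import Order.TTheory GRing.Theory Num.Theory.
Local Open Scope ring_scope.

(** * Spectral theory of symmetric matrices *)

Lemma mulmx_tr_ge0 (R : realDomainType) (n : nat) (x : 'rV[R]_n) :
  0 <= (x *m x^T) 0 0.
Proof. by rewrite mxE sumr_ge0 // => i _; rewrite !mxE -expr2 sqr_ge0. Qed.

Lemma mulmx_tr_eq0 (R : realDomainType) (n : nat) (x : 'rV[R]_n) :
  ((x *m x^T) 0 0 == 0) = (x == 0).
Proof.
apply/idP/eqP => [|->]; last by rewrite mul0mx mxE.
rewrite mxE psumr_eq0 => [/allP x0|i _]; last by rewrite !mxE -expr2 sqr_ge0.
apply/rowP => i; rewrite mxE.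
by have := x0 i (mem_index_enum i); rewrite !mxE mulf_eq0 orbb => /eqP.
Qed.

(** The sizes are only propositionally equal because [P] will stack bases of two subspaces, whose
    row count [\rank E + \rank K] is not convertible to [n]. *)
Lemma char_poly_conj (F : fieldType) (m n : nat) (P : 'M[F]_(m, n))
    (A : 'M[F]_n) (B : 'M[F]_m) :
  m = n -> row_free P -> P *m A = B *m P -> char_poly A = char_poly B.
Proof.
move=> mn; case: n / mn P A => P A; rewrite row_free_unit => Pu PA.
have P0 : \det (map_mx (@polyC F) P) != 0.
  by rewrite det_map_mx polyC_eq0 -unitfE -unitmxE.
apply: (mulfI P0); rewrite [RHS]mulrC -!det_mulmx.
congr (\det _); rewrite /char_poly_mx mulmxBr mulmxBl -!map_mxM PA.
by rewrite scalar_mxC.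
Qed.

(* The eigenspace [E] and its orthogonal are both stable under [M], so the
   characteristic polynomial factors accordingly; the second factor does not
   vanish at [a], since an eigenvector in the orthogonal of [E] would be
   orthogonal to itself. *)
Lemma mup_char_poly_sym (R : realFieldType) (n : nat) (M : 'M[R]_n) (a : R) :
  M^T = M -> mup a (char_poly M) = \rank (eigenspace M a).
Proof.
move=> symM; set E := eigenspace M a; set K := kermx E^T.
pose P := col_mx (row_base E) (row_base K).
have EM : E *m M = a *: E by apply/eigenspaceP.
have KE (v : 'rV_n) : (v <= K)%MS -> (v <= E)%MS -> v = 0.
  move=> /sub_kermxP vE /submxP [w vw]; apply/eqP.
  by rewrite -mulmx_tr_eq0 {2}vw trmx_mul mulmxA vE mul0mx mxE.
have EK0 : (E :&: K = 0)%MS.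
  apply/eqP/rowV0P => v; rewrite sub_capmx => /andP[vE vK]; exact: KE.
have rE : (\rank E + \rank K = n)%N.
  have -> : \rank K = (n - \rank E)%N by rewrite [LHS]mxrank_ker mxrank_tr.
  by rewrite subnKC // rank_leq_row.
have freeP : row_free P.
  rewrite /row_free /P -addsmxE (adds_eqmx (eq_row_base E) (eq_row_base K)).
  by have := mxrank_sum_cap E K; rewrite EK0 mxrank0 addn0 => ->.
have KM : (row_base K *m M <= row_base K)%MS.
  rewrite eq_row_base; apply/sub_kermxP.
  have /sub_kermxP K0 : (row_base K <= K)%MS by rewrite eq_row_base.
  by rewrite -mulmxA -{1}symM -trmx_mul EM linearZ -scalemxAr /= K0 scaler0.
have [N NK] := submxP KM.
have EbM : row_base E *m M = a *: row_base E.
  by apply/eigenspaceP; rewrite eq_row_base.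
have PM : P *m M = block_mx a%:M 0 0 N *m P.
  rewrite /P mul_col_mx EbM NK mul_block_col !mul0mx addr0 add0r.
  by rewrite mul_scalar_mx.
rewrite (char_poly_conj _ _ _ _ _ _ rE freeP PM).
rewrite [char_poly _]/char_poly char_block_diag_mx det_ublock -!/(char_poly _).
have -> : char_poly (a%:M : 'M_(\rank E)) = ('X - a%:P) ^+ \rank E.
  rewrite char_poly_trig; last by apply/is_trig_mxP => i j ij; rewrite !mxE -val_eqE ltn_eqF.
  by under eq_bigr do rewrite mxE eqxx; rewrite prodr_const card_ord.
rewrite mupMl ?mup_XsubCX ?eqxx // -eigenvalue_root_char.
apply/eigenvalueP => -[v vN]; apply/negP; rewrite negbK.
have /eqP : v *m row_base K = 0.
  apply: KE; first by rewrite (submx_trans (submxMl _ _)) ?eq_row_base.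
  by apply/eigenspaceP; rewrite -mulmxA NK mulmxA vN scalemxAl.
by rewrite mulmx_free_eq0 // row_base_free.
Qed.

(** [V] is the sum of the eigenspaces for eigenvalues in [I]. Distinct eigenspaces are independent
    and orthogonal, so the ranks add up, kernel vectors are orthogonal to [V] when [I] avoids 0, and
    the quadratic form on [V] is a sum over eigencomponents. *)
Lemma eigenspaces_sym (R : rcfType) (n : nat) (M : 'M[R]_n) (I : interval R) :
  M^T = M ->
  exists V : 'M[R]_n,
    [/\ \rank V = eigenvalue_count M I,
        forall u : 'rV_n, u *m M = 0 -> 0 \notin I ->
          forall y : 'rV_n, (y <= V)%MS -> (y *m u^T) 0 0 = 0 &
        forall a, (forall x, x \in I -> a < x) ->
          forall y : 'rV_n, (y <= V)%MS -> y != 0 ->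
          a * (y *m y^T) 0 0 < (y *m M *m y^T) 0 0].
Proof.
move=> symM; set s := [seq x <- rootsR (char_poly M) | x \in I].
have us : uniq s.
  by rewrite filter_uniq // (sorted_uniq lt_trans ltxx) // sorted_roots.
have sI (i : 'I_(size s)) : s`_i \in I.
  by have := mem_nth 0 (ltn_ord i); rewrite mem_filter => /andP[].
have orth (x y : 'rV_n) (b c : R) : (x <= eigenspace M b)%MS ->
    (y <= eigenspace M c)%MS -> b != c -> x *m y^T = 0.
  move=> /eigenspaceP xM /eigenspaceP yM bc.
  have : (b - c) *: (x *m y^T) = 0.
    rewrite scalerBl scalemxAl -xM -mulmxA -{1}symM -trmx_mul yM linearZ /=.
    by rewrite -scalemxAr subrr.
  by move/eqP; rewrite scaler_eq0 subr_eq0 (negPf bc) => /eqP.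
exists (\sum_(i < size s) eigenspace M s`_i)%MS; split.
- have Vdirect : mxdirect (\sum_(i < size s) eigenspace M s`_i)%MS.
    apply: mxdirect_sum_eigenspace => i j _ _ /eqP.
    by rewrite nth_uniq // => /eqP /val_inj.
  rewrite /eigenvalue_count -big_filter -/s (big_nth 0) big_mkord
    (mxdirectP Vdirect) /=.
  apply: eq_bigr => i _; exact: esym (mup_char_poly_sym _ _ _ _ symM).
- move=> u uM I0 y /sub_sumsmxP[w ->]; rewrite mulmx_suml summxE big1 // => i _.
  rewrite (orth _ _ s`_i 0) ?mxE ?submxMl //.
    by apply/eigenspaceP; rewrite uM scale0r.
  by apply: contraNneq I0 => <-.
move=> a Ia y /sub_sumsmxP[w yw] y0.
pose z (i : 'I_(size s)) := w i *m eigenspace M s`_i.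
have zE i : (z i <= eigenspace M s`_i)%MS by exact: submxMl.
have zz i j : i != j -> z i *m (z j)^T = 0.
  move=> ij; apply: (orth _ _ _ _ (zE i) (zE j)).
  by rewrite nth_uniq.
(* By orthogonality only the diagonal pairings survive. This is used with the eigenvalues as
   coefficients for the form, and with 1 for the squared norm. *)
have dotE (c : 'I_(size s) -> R) : ((\sum_i c i *: z i) *m y^T) 0 0 =
    \sum_i c i * (z i *m (z i)^T) 0 0.
  rewrite mulmx_suml summxE; apply: eq_bigr => i _.
  rewrite yw linear_sum -scalemxAl mulmx_sumr (bigD1 i) //= big1 ?addr0 ?mxE //.
  by move=> j ji; apply: zz; rewrite eq_sym.
have -> : y *m M = \sum_(i < size s) s`_i *: z i.
  rewrite {1}yw mulmx_suml; apply: eq_bigr => i _; exact/eigenspaceP/zE.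
have -> : (y *m y^T) 0 0 = \sum_i 1 * (z i *m (z i)^T) 0 0.
  by rewrite -dotE {1}yw; under [in RHS]eq_bigr do rewrite scale1r.
have za (i : 'I_(size s)) : 0 <= (s`_i - a) * (z i *m (z i)^T) 0 0.
  by rewrite mulr_ge0 ?mulmx_tr_ge0 // subr_ge0 ltW ?Ia.
rewrite dotE mulr_sumr -subr_gt0 -sumrB.
under eq_bigr do rewrite mul1r -mulrBl.
(* Strictness: if the sum of the nonnegative terms were 0, every component [z i], and hence [y],
   would vanish. *)
rewrite lt0r sumr_ge0 // andbT psumr_eq0 //; apply: contraNN y0 => /allP z0.
rewrite yw big1 // => i _; apply/eqP.
have := z0 i (mem_index_enum i); rewrite mulf_eq0 mulmx_tr_eq0 subr_eq0.
by rewrite gt_eqF ?Ia.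
Qed.

(* The eigenvectors for eigenvalues in [I], together with [u], span a space of
   dimension [eigenvalue_count M I + 1], on which the quadratic form
   [x M x^T - a |x|^2 + b (x u^T)^2] is positive definite; if that dimension
   exceeded [s], the space would contain a nonzero vector killed by [B]. *)
Lemma eigenvalue_count_lt (R : rcfType) (n s : nat) (M : 'M[R]_n)
    (I : interval R) (u : 'rV[R]_n) (a b : R) (B : 'M[R]_(n, s)) :
  M^T = M -> u *m M = 0 -> u != 0 -> 0 \notin I ->
  (forall x, x \in I -> a < x) -> a < b * (u *m u^T) 0 0 ->
  (forall x : 'rV_n, x *m B = 0 ->
     (x *m M *m x^T) 0 0 <= a * (x *m x^T) 0 0 - b * (x *m u^T) 0 0 ^+ 2) ->
  (eigenvalue_count M I < s)%N.
Proof.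
move=> symM uM u0 I0 Ia aub xB.
have [V [rV Vu VM]] := eigenspaces_sym _ _ _ I symM.
rewrite -rV ltnNge; apply/negP => sV.
have Vu0 : (V :&: u = 0)%MS.
  apply/eqP/rowV0P => v; rewrite sub_capmx => /andP[vV /sub_rVP[c vc]].
  have := Vu u uM I0 v vV; rewrite vc -scalemxAl mxE => /eqP.
  by rewrite mulf_eq0 mulmx_tr_eq0 (negPf u0) orbF => /eqP->; rewrite scale0r.
have rVu : \rank (V + u)%MS = (\rank V).+1.
  by have := mxrank_sum_cap V u; rewrite Vu0 mxrank0 rank_rV u0 addn0 addn1.
have : ((V + u) :&: kermx B)%MS != 0.
  rewrite -mxrank_eq0 -lt0n.
  have := mxrank_sum_cap (V + u)%MS (kermx B); rewrite rVu mxrank_ker.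
  have := rank_leq_row ((V + u) + kermx B)%MS.
  have := rank_leq_col B; have := rank_leq_row B; lia.
case/rowV0Pn => x; rewrite sub_capmx => /andP[/sub_addsmxP[[w c] /= xE]].
move=> /sub_kermxP xB0; apply/negP; rewrite negbK; move: xE.
have : (w *m V <= V)%MS by exact: submxMl.
move: (w *m V) => y yV; have [k ->] : exists k, c *m u = k *: u.
  by apply/sub_rVP; exact: submxMl.
move=> xE; have yu := Vu u uM I0 y yV.
have uy : (u *m y^T) 0 0 = 0 by rewrite -(trmxK u) -trmx_mul mxE.
have := xB x xB0; rewrite xE.
have -> : (y + k *: u) *m M = y *m M by rewrite mulmxDl -scalemxAl uM scaler0 addr0.
have Mu : M *m u^T = 0 by rewrite -{1}symM -trmx_mul uM trmx0.
have -> : y *m M *m (y + k *: u)^T = y *m M *m y^T.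
  by rewrite linearD linearZ /= mulmxDr -scalemxAr -(mulmxA y M u^T) Mu mulmx0 scaler0 addr0.
have -> : ((y + k *: u) *m (y + k *: u)^T) 0 0 =
   (y *m y^T) 0 0 + k ^+ 2 * (u *m u^T) 0 0.
  rewrite linearD linearZ /= mulmxDr !mulmxDl -!scalemxAr -!scalemxAl.
  by move: yu uy; rewrite !mxE => -> ->; ring.
have -> : ((y + k *: u) *m u^T) 0 0 = k * (u *m u^T) 0 0.
  by rewrite mulmxDl -scalemxAl; move: yu; rewrite !mxE => ->; ring.
have uu : 0 < (u *m u^T) 0 0 by rewrite lt0r mulmx_tr_eq0 u0 mulmx_tr_ge0.
(* The bound from [VM] is strict only for nonzero [y]; for [y = 0] the contradiction comes from
   [a < b * (u *m u^T) 0 0]. *)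
have [->|y0] := eqVneq y 0.
  rewrite !mul0mx add0r mxE => uk.
  rewrite scaler_eq0 (negPf u0) orbF -sqrf_eq0 eq_le sqr_ge0 andbT.
  rewrite leNgt; apply/negP => k0.
  have : 0 < k ^+ 2 * (u *m u^T) 0 0 by rewrite mulr_gt0.
  nra.
move=> yM; have := VM a Ia y yV y0; rewrite ltNge => /negP[].
apply: (le_trans yM); have := mulr_ge0 (sqr_ge0 k) (ltW uu).
nra.
Qed.

(** * Distances in diameter at most 2 *)

Lemma bigmin_le (T : eqType) (r : seq T) (P : pred T) (F : T -> nat) (m : nat)
    (k : T) :
  k \in r -> P k -> (\big[minn/m]_(i <- r | P i) F i <= F k)%N.
Proof.
move=> + Pk; elim: r => //= i r IH; rewrite inE big_cons => /orP[/eqP <-|/IH kr].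
  by rewrite Pk geq_minl.
by case: ifP => // _; rewrite (leq_trans (geq_minr _ _)).
Qed.

Lemma has_path_lt (G : sgraph) (u v : G) (k : nat) : has_path u v k -> (k < #|G|)%N.
Proof.
case/existsP => p /and3P[_ /card_uniqP pE _].
by rewrite -[k](size_tuple p) -[_.+1]/(size (u :: p)) -pE max_card.
Qed.

Lemma dist_le (G : sgraph) (u v : G) (k : nat) :
  has_path u v k -> (dist u v <= k)%N.
Proof.
move=> uvk; have kG := has_path_lt _ _ _ _ uvk.
exact: (bigmin_le _ _ _ _ _ (Ordinal kG) (mem_index_enum _) uvk).
Qed.

Lemma has_path_dist (G : sgraph) (u v : G) :
  connect (@adj G) u v -> has_path u v (dist u v).
Proof.
case/connectP => p0 /shortenP[p uvp up _] vp.
have uvk : has_path u v (size p).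
  by apply/existsP; exists (in_tuple p); rewrite uvp up vp eqxx.
have : (dist u v < #|G|)%N.
  by rewrite (leq_ltn_trans (dist_le _ _ _ _ uvk)) ?(has_path_lt _ _ _ _ uvk).
(* The induction carries the bound as a premise, which makes the case of the default value [#|G|]
   vacuous. *)
rewrite /dist; elim/big_ind: _ => [|m1 m2 H1 H2|//]; first by rewrite ltnn.
by rewrite /minn; case: ifP.
Qed.

Lemma dist_le_diameter (G : sgraph) (u v : G) : (dist u v <= diameter G)%N.
Proof. exact: leq_trans (leq_bigmax v) (leq_bigmax u). Qed.

Lemma diam2_path (G : sgraph) (u v : G) :
  connected_graph G -> (diameter G <= 2)%N ->
  u != v -> ~~ adj u v -> exists2 w, adj u w & adj w v.
Proof.
move=> [_ cG] dG uv nuv; have := has_path_dist _ _ _ (cG u v).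
have := leq_trans (dist_le_diameter _ u v) dG.
case: (dist u v) => [|[|[|//]]] _ /existsP[p].
- by rewrite (tuple0 p) /= (negPf uv).
- case/tupleP: p => x p; rewrite (tuple0 p) /= andbT => /and3P[ux _ /eqP xv].
  by rewrite -xv ux in nuv.
case/tupleP: p => w p; case/tupleP: p => x p; rewrite (tuple0 p) /= andbT.
by move=> /and3P[/andP[uw wx] _ /eqP <-]; exists w.
Qed.

Lemma dist_diam2 (G : sgraph) (u v : G) :
  connected_graph G -> (diameter G <= 2)%N ->
  dist u v = if u == v then 0%N else if adj u v then 1%N else 2%N.
Proof.
move=> G_connected dG; have := has_path_dist _ _ _ (G_connected.2 u v).
have := leq_trans (dist_le_diameter _ u v) dG.
have dist0 : u = v -> dist u v = 0%N.
  move=> <-; apply/eqP; rewrite -leqn0; apply: dist_le.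
  by apply/existsP; exists [tuple] => /=.
have dist1 : u != v -> adj u v -> (dist u v <= 1)%N.
  move=> uv a; apply: dist_le; apply/existsP; exists [tuple v] => /=.
  by rewrite a inE uv eqxx.
case: eqVneq => [/dist0->//|uv]; case: ifP => auv.
  have := dist1 uv auv; case: (dist u v) => [|[|//]] // _ _ /existsP[p].
  by rewrite (tuple0 p) /= (negPf uv).
case: (dist u v) => [|[|[|//]]] _ /existsP[p] //.
  by rewrite (tuple0 p) /= (negPf uv).
case/tupleP: p => x p; rewrite (tuple0 p) /= andbT => /and3P[ux _ /eqP xv].
by rewrite -xv ux in auv.
Qed.

(** * Energy and the quadratic form of the distance Laplacian *)

(** The Laplacian quadratic form; each edge occurs as two ordered pairs, hence the division by 2. *)
Definition energy (R : fieldType) (G : sgraph) (f : G -> R) : R :=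
  (\sum_u \sum_(v | adj u v) (f u - f v) ^+ 2) / 2.

Lemma dist_laplacian_sym (R : rcfType) (G : sgraph) :
  connected_graph G -> (diameter G <= 2)%N ->
  (dist_laplacian R G)^T = dist_laplacian R G.
Proof.
move=> cG dG; rewrite /dist_laplacian linearB /= tr_diag_mx; congr (_ - _).
by apply/matrixP => i j; rewrite !mxE !dist_diam2 // eq_sym adj_sym.
Qed.

Lemma sum_rank (V : nmodType) (T : finType) (F : T -> V) :
  \sum_(i < #|T|) F (enum_val i) = \sum_v F v.
Proof. by rewrite -big_enum_val. Qed.

Lemma dist_laplacian_const (R : rcfType) (G : sgraph) :
  const_mx 1 *m dist_laplacian R G = 0 :> 'rV_#|G|.
Proof.
rewrite mulmxBr; apply/rowP => j; rewrite mul_mx_diag !mxE mul1r.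
apply/eqP; rewrite subr_eq0 /transmission natr_sum.
rewrite -(sum_rank _ _ (fun u => (dist u (enum_val j))%:R)).
by apply/eqP/eq_bigr => i _; rewrite !mxE mul1r.
Qed.

Lemma dist_laplacian_quad (R : rcfType) (G : sgraph) (x : 'rV[R]_#|G|) :
  connected_graph G -> (diameter G <= 2)%N ->
  let f v := x 0 (enum_rank v) in
  (x *m dist_laplacian R G *m x^T) 0 0 =
  2 * #|G|%:R * (\sum_v f v ^+ 2) - 2 * (\sum_v f v) ^+ 2 - energy R G f.
Proof.
move=> cG dG f.
have fE i : x 0 i = f (enum_val i) by rewrite /f enum_valK.
have -> : (x *m dist_laplacian R G *m x^T) 0 0 =
    \sum_v \sum_u (dist u v)%:R * (f v ^+ 2 - f u * f v).
  rewrite -(sum_rank _ _ (fun v => \sum_u (dist u v)%:R * (f v ^+ 2 - f u * f v))).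
  rewrite mxE; apply: eq_bigr => j _.
  rewrite mulmxBr mul_mx_diag !mxE fE.
  under [RHS]eq_bigr do rewrite mulrBr; rewrite sumrB mulrBl.
  congr (_ - _).
    rewrite -mulr_suml -natr_sum; ring.
  rewrite -(sum_rank _ _ (fun u => (dist u (enum_val j))%:R *
    (f u * f (enum_val j)))) mulr_suml.
  by apply: eq_bigr => i _; rewrite !mxE fE; ring.
have distE (u v : G) : (dist u v)%:R = 2 - 2 * (u == v)%:R - (adj u v)%:R :> R.
  rewrite dist_diam2 //; have [->|_] := eqVneq u v; first by rewrite adj_irr /=; ring.
  by case: ifP => _ /=; ring.
have symE : \sum_v \sum_u (adj u v)%:R * (f v ^+ 2 - f u * f v) = energy R G f.
  pose S := \sum_v \sum_u (adj u v)%:R * (f v ^+ 2 - f u * f v).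
  (* Swapping the two vertices gives a second expression for [S]; added to the first, it completes
     the square [(f u - f v) ^+ 2]. *)
  have SE : S = \sum_v \sum_u (adj u v)%:R * (f u ^+ 2 - f u * f v).
    rewrite /S exchange_big /=; apply: eq_bigr => v _; apply: eq_bigr => u _.
    by rewrite adj_sym (mulrC (f u)).
  suff : S + S = \sum_u \sum_(v | adj u v) (f u - f v) ^+ 2.
    by rewrite /energy -/S => <-; field.
  rewrite {1}SE -big_split /=; apply: eq_bigr => v _.
  rewrite -big_split [RHS]big_mkcond /=; apply: eq_bigr => u _.
  by rewrite adj_sym; case: ifP => _ /=; ring.
rewrite -symE.
under eq_bigr => v _ do under eq_bigr => u _ do rewrite distE 2!mulrBl.
under eq_bigr => v _ do rewrite 2!sumrB.
rewrite 2!sumrB; congr (_ - _).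
have -> : \sum_v \sum_u 2 * (u == v)%:R * (f v ^+ 2 - f u * f v) = 0.
  apply: big1 => v _; apply: big1 => u _.
  by have [->|_] := eqVneq u v => /=; ring.
rewrite subr0; transitivity (\sum_v (2 * #|G|%:R * f v ^+ 2 - 2 * (\sum_u f u) * f v)).
  apply: eq_bigr => v _.
  rewrite -mulr_sumr sumrB sumr_const -mulr_suml -(mulr_natl (f v ^+ 2)); ring.
by rewrite sumrB -!mulr_sumr; ring.
Qed.

(** This is [eigenvalue_count_lt] for the all-ones vector, [a = 2n - 1] and [b = 2]: in
    [dist_laplacian_quad] the terms in the sum of [f] cancel, leaving squared norm at most energy.
    The columns of [B] are [s] linear conditions on [f]. *)
Lemma dist_laplacian_count (R : rcfType) (G : sgraph) (s : nat)
    (B : G -> 'I_s -> R) :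
  connected_graph G -> (diameter G <= 2)%N ->
  (forall f : G -> R, (forall j, \sum_v f v * B v j = 0) ->
     \sum_v f v ^+ 2 <= energy R G f) ->
  (eigenvalue_count (dist_laplacian R G)
     `](2 * #|G|%:R - 1 : R)%R, (2 * #|G|%:R : R)%R[ < s)%N.
Proof.
move=> cG dG fB; have n1 : 1 <= #|G|%:R :> R by rewrite ler1n; case: cG.
pose one : 'rV[R]_#|G| := const_mx 1.
have uu : (one *m one^T) 0 0 = #|G|%:R.
  rewrite mxE (eq_bigr (fun=> 1)) => [|i _]; last by rewrite !mxE mulr1.
  by rewrite sumr_const card_ord.
apply: (eigenvalue_count_lt _ _ _ _ _ one (2 * #|G|%:R - 1) 2
  (\matrix_(i, j) B (enum_val i) j)).
- exact: dist_laplacian_sym.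
- exact: dist_laplacian_const.
- by rewrite -mulmx_tr_eq0 uu; lra.
- by rewrite in_itv /=; lra.
- by move=> x; rewrite in_itv /= => /andP[].
- by rewrite uu; lra.
move=> x xB; rewrite dist_laplacian_quad //=.
set f := fun v => x 0 (enum_rank v).
have fE i : x 0 i = f (enum_val i) by rewrite /f enum_valK.
have -> : (x *m x^T) 0 0 = \sum_v f v ^+ 2.
  rewrite mxE -(sum_rank _ _ (fun v => f v ^+ 2)).
  by apply: eq_bigr => i _; rewrite mxE fE.
have -> : (x *m one^T) 0 0 = \sum_v f v.
  by rewrite mxE -(sum_rank _ _ f); apply: eq_bigr => i _; rewrite !mxE fE mulr1.
have /fB : forall j, \sum_v f v * B v j = 0.
  move=> j; have /matrixP/(_ 0 j) := xB; rewrite !mxE => xB0; rewrite -[RHS]xB0.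
  rewrite -(sum_rank _ _ (fun v => f v * B v j)).
  by apply: eq_bigr => i _; rewrite mxE fE.
lra.
Qed.

(** * Cuts, dominating sets and bipartite subgraphs *)

(** The double sum in [energy] meets each cut edge from both ends, so halving leaves one copy of the
    cut; the remaining terms are squares. *)
Lemma energy_cut (R : realFieldType) (G : sgraph) (f : G -> R) (A : {set G}) :
  \sum_(u in A) \sum_(v in ~: A | adj u v) (f u - f v) ^+ 2 <= energy R G f.
Proof.
set c := \sum_(u in A) _.
have cE : c = \sum_(u in ~: A) \sum_(v in A | adj u v) (f u - f v) ^+ 2.
  rewrite /c (exchange_big_dep (fun v => v \in ~: A)) /=; last by move=> u v _ /andP[].
  apply: eq_bigr => v vA; apply: eq_big => [u|u _]; last by rewrite -sqrrN opprB.
  by rewrite vA adj_sym.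
suff : c + c <= \sum_u \sum_(v | adj u v) (f u - f v) ^+ 2.
  by rewrite /energy ler_pdivlMr //; lra.
rewrite [leRHS](bigID (mem A)) /= {2}cE; apply: lerD.
  apply: ler_sum => u _; rewrite [leRHS](bigID (mem (~: A))) /=.
  under eq_bigl do rewrite andbC.
  by rewrite lerDl sumr_ge0 // => v _; rewrite sqr_ge0.
under [leLHS]eq_bigl do rewrite inE.
apply: ler_sum => u _; rewrite [leRHS](bigID (mem A)) /=.
under eq_bigl do rewrite andbC.
by rewrite lerDl sumr_ge0 // => v _; rewrite sqr_ge0.
Qed.

Lemma count_lt_dominating (R : rcfType) (G : sgraph) (S : {set G}) :
  connected_graph G -> (diameter G <= 2)%N ->
  (forall v, v \notin S -> exists2 w, w \in S & adj v w) ->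
  (eigenvalue_count (dist_laplacian R G)
     `](2 * #|G|%:R - 1 : R)%R, (2 * #|G|%:R : R)%R[ < #|S|)%N.
Proof.
move=> cG dG domS.
apply: (dist_laplacian_count _ _ _ (fun v j => (v == enum_val j)%:R)) => // f fS.
have f0 v : v \in S -> f v = 0.
  move=> vS; rewrite -[RHS](fS (enum_rank_in vS v)) enum_rankK_in //.
  rewrite (bigD1 v) //= eqxx mulr1 big1 ?addr0 // => w /negPf->.
  by rewrite mulr0.
(* Each vertex [v] outside [S] has a cut edge to some [w] in [S], where [f] vanishes; that edge
   alone contributes [f v ^+ 2]. *)
apply: le_trans (energy_cut _ _ _ (~: S)); rewrite setCK.
rewrite (bigID (mem S)) /= big1 ?add0r => [|v vS]; last by rewrite f0 // expr0n.
under [leRHS]eq_bigl do rewrite inE.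
apply: ler_sum => v /domS[w wS vw].
rewrite (bigD1 w) ?wS //= (f0 w) // subr0 lerDl.
by rewrite sumr_ge0 // => z _; rewrite sqr_ge0.
Qed.

(** The single condition that [f] sums to 0 suffices, so the count is below 1. If [f] sums to [a] on
    [A], it sums to [- a] on the complement, and the cut has energy [#|A|] times the squared norm
    plus [2 * a ^+ 2]. *)
Lemma count_eq0_bipartite (R : rcfType) (G : sgraph) (A : {set G}) :
  connected_graph G -> (diameter G <= 2)%N -> #|A| = #|~: A| ->
  (forall u v, u \in A -> v \notin A -> adj u v) ->
  eigenvalue_count (dist_laplacian R G)
    `](2 * #|G|%:R - 1 : R), (2 * #|G|%:R : R)[ = 0%N.
Proof.
move=> cG dG cardA adjA; apply/eqP; rewrite -leqn0 -ltnS.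
apply: (dist_laplacian_count _ _ _ (fun _ _ => 1)) => // f /(_ 0).
under eq_bigr do rewrite mulr1.
move=> f0; apply: le_trans (energy_cut _ _ _ A).
have k1 : 1 <= #|A|%:R :> R.
  rewrite ler1n lt0n; apply/eqP => A0; case: cG.
  by rewrite -(cardsC A) -cardA A0.
have -> : \sum_(u in A) \sum_(v in ~: A | adj u v) (f u - f v) ^+ 2 =
  \sum_(u in A) \sum_(v in ~: A) (f u - f v) ^+ 2.
  apply: eq_bigr => u uA; apply: eq_bigl => v; rewrite inE andbC.
  by have [//|vA] := boolP (v \in A); rewrite ?andbF // adjA.
have -> : \sum_(u in A) \sum_(v in ~: A) (f u - f v) ^+ 2 =
    #|A|%:R * \sum_v f v ^+ 2 - 2 * (\sum_(u in A) f u) * (\sum_(v in ~: A) f v).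
  rewrite [in RHS](bigID (mem A)) /=.
  transitivity (\sum_(u in A) (#|A|%:R * f u ^+ 2 + \sum_(v in ~: A) f v ^+ 2
     - 2 * f u * \sum_(v in ~: A) f v)).
    apply: eq_bigr => u _.
    under eq_bigr do rewrite sqrrB.
    rewrite big_split sumrB /= sumr_const -cardA -(mulr_natl (f u ^+ 2)) [RHS]addrAC.
    by rewrite mulr_sumr; congr (_ - _ + _); apply: eq_bigr => v _; ring.
  rewrite sumrB big_split /= sumr_const -mulr_natl -mulr_sumr -mulr_suml -mulr_sumr.
  have -> : \sum_(v in ~: A) f v ^+ 2 = \sum_(i | i \notin A) f i ^+ 2.
    by apply: eq_bigl => v; rewrite inE.
  ring.
have : \sum_(u in A) f u + \sum_(v in ~: A) f v = 0.
  rewrite -[RHS]f0 [RHS](bigID (mem A)) /=; congr (_ + _).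
  by apply: eq_bigl => v; rewrite inE.
have : 0 <= \sum_v f v ^+ 2 by rewrite sumr_ge0 // => v _; rewrite sqr_ge0.
have := sqr_ge0 (\sum_(u in A) f u).
move: (\sum_(u in A) f u) (\sum_(v in ~: A) f v) (\sum_v f v ^+ 2) => a b t.
move=> a2 t0 /eqP; rewrite addrC addr_eq0 => /eqP ->.
have : 0 <= (#|A|%:R - 1) * t by rewrite mulr_ge0 // subr_ge0.
lra.
Qed.

Lemma neighborhood_dominating (G : sgraph) (v : G) :
  connected_graph G -> (diameter G <= 2)%N -> (1 < #|G|)%N ->
  forall u, u \notin [set w | adj v w] ->
  exists2 w, w \in [set w | adj v w] & adj u w.
Proof.
move=> cG dG n1 u; rewrite inE => nvu; have [->|uv] := eqVneq u v; last first.
  have [|w vw wu] := diam2_path _ v u cG dG _ nvu; first by rewrite eq_sym.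
  by exists w; rewrite ?inE // adj_sym.
(* The case [u = v] needs some neighbour of [v]: another vertex [w] is itself one, or is reached
   through one. *)
have /card_gt0P[w] : (0 < #|predC1 v|)%N by rewrite -ltnS cardC1 prednK // ltnW.
rewrite !inE => wv; have [vw|nvw] := boolP (adj v w); first by exists w; rewrite ?inE.
have [|x vx _] := diam2_path _ v w cG dG _ nvw; first by rewrite eq_sym.
by exists x; rewrite ?inE.
Qed.

Lemma independence_number_attained (G : sgraph) :
  exists2 A : {set G}, independent A & #|A| = independence_number G.
Proof.
have ind0 : independent (set0 : {set G}).
  by apply/'forall_implyP => u; rewrite inE.
rewrite /independence_number.
have card_ind : (0 < #|@independent G|)%N by apply/card_gt0P; exists set0.
by have [A indA ->] := eq_bigmax_cond (fun A : {set G} => #|A|) card_ind; exists A.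
Qed.

(** * Coronas of diameter at most 2 *)

Definition point_graph : sgraph :=
  @SGraph unit (fun _ _ => false) (fun _ _ => erefl) (fun _ => erefl).

Lemma point_graph_connected : connected_graph point_graph.
Proof. by split=> [|[] []]; [rewrite card_unit | exact: connect0]. Qed.

Lemma two_vertex_corona (G : sgraph) (a b : G) :
  a != b -> adj a b -> (forall v : G, v = a \/ v = b) ->
  graph_iso G (corona_K1 point_graph).
Proof.
move=> ab adjab all_ab; pose f v : corona_K1 point_graph :=
  if v == a then inl tt else inr tt.
have ba : (b == a) = false by rewrite eq_sym (negPf ab).
exists f; split.
  exists (fun x => if x is inl _ then a else b).
    by move=> v; case: (all_ab v) => ->; rewrite /f ?eqxx ?ba.
  by case=> [[]|[]]; rewrite /f ?eqxx ?ba.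
move=> u v; rewrite /f.
by case: (all_ab u) (all_ab v) => -> [] ->;
  rewrite ?eqxx ?ba /= ?eqxx ?adj_irr ?adjab // adj_sym adjab.
Qed.

Lemma corona_diam2 (G H : sgraph) :
  connected_graph G -> (diameter G <= 2)%N -> connected_graph H ->
  graph_iso G (corona_K1 H) ->
  exists a b : G, [/\ a != b, adj a b & forall v, v = a \/ v = b].
Proof.
move=> cG dG [/card_gt0P[h _] _] [f [[g fK gK] fadj]].
have oneH k : k = h.
  apply/eqP/negPn/negP => kh.
  have [||w] := diam2_path _ (g (inr k)) (g (inr h)) cG dG.
  - by rewrite (inj_eq (can_inj gK)).
  - by rewrite -fadj !gK.
  (* A common neighbour of the two pendant vertices must be a base vertex equal to both [k] and
     [h]. *)
  rewrite -!fadj !gK; case: (f w) => //= x /eqP kx /eqP xh.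
  by rewrite kx xh eqxx in kh.
exists (g (inl h)), (g (inr h)); split.
- by rewrite (inj_eq (can_inj gK)).
- by rewrite -fadj !gK /=.
by move=> v; rewrite -[v]fK; case: (f v) => k; rewrite (oneH k); [left|right].
Qed.

Theorem theorem3p9 (R : realType) (G : sgraph)
    (G_connected : connected_graph G) (diam_le2 : (diameter G <= 2)%N) :
  ((eigenvalue_count (dist_laplacian R G)
      `](2 * #|G|%:R - 1 : R), (2 * #|G|%:R : R)[)%:R
     = (independence_number G)%:R - 1 :> R
   /\ (independence_number G)%:R - 1 = #|G|%:R / 2 - 1 :> R)
  <->
  (exists H : sgraph, connected_graph H /\ graph_iso G (corona_K1 H)).
Proof.
have n0 := G_connected.1; have [A indA cardA] := independence_number_attained G.
split=> [[count_eq half]|[H [cH isoGH]]].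
  have n2 : #|G| = (2 * #|A|)%N.
    by apply/eqP; rewrite -(eqr_nat R) natrM cardA; apply/eqP; lra.
  have mA : (eigenvalue_count (dist_laplacian R G)
      `](2 * #|G|%:R - 1 : R)%R, (2 * #|G|%:R : R)%R[).+1 = #|A|.
    by apply/eqP; rewrite -(eqr_nat R) -natr1 count_eq cardA; apply/eqP; lra.
  have cardAC : #|A| = #|~: A| by have := cardsC A; lia.
  (* Independence puts the neighbourhood inside [~: A]; being dominating, it has more elements than
     the count, hence at least [#|A| = #|~: A|]. *)
  have nbrA v : v \in A -> [set w | adj v w] = ~: A.
    move=> vA; apply/eqP; rewrite eqEcard; apply/andP; split.
      apply/subsetP => w; rewrite !inE; apply: contraTN => wA.
      by move/forall_inP/(_ v vA)/forall_inP/(_ w wA): indA.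
    rewrite -cardAC -mA; apply: count_lt_dominating => //.
    by apply: neighborhood_dominating => //; lia.
  have adjA u v : u \in A -> v \notin A -> adj u v.
    by move=> /nbrA/setP/(_ v); rewrite !inE => ->.
  (* The complete balanced bipartite subgraph makes the count 0, and [mA] says that [#|A|] is its
     successor. *)
  have /cards1P[a Aa] : #|A| == 1%N.
    by rewrite -mA (count_eq0_bipartite R G A).
  have /cards1P[b Ab] : #|~: A| == 1%N by rewrite -cardAC Aa cards1.
  have bA : b \notin A by rewrite -in_setC Ab set11.
  exists point_graph; split; first exact: point_graph_connected.
  apply: (two_vertex_corona G a b).
  - by move: bA; rewrite Aa inE eq_sym.
  - by apply: adjA => //; rewrite Aa set11.
  move=> v; have [|] := boolP (v \in A); first by rewrite Aa inE => /eqP; left.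
  by rewrite -in_setC Ab inE => /eqP; right.
(* Here [G] is a single edge: [n = 2], the independence number is 1, and the bipartition into [a]
   and [b] makes the count 0. *)
have [a [b [ab adjab all_ab]]] := corona_diam2 G H G_connected diam_le2 cH isoGH.
have ba : (b == a) = false by rewrite eq_sym (negPf ab).
have bC : ~: [set a] = [set b].
  by apply/setP => v; rewrite !inE; case: (all_ab v) => ->; rewrite eqxx ?ba ?(negPf ab).
have nG : #|G| = 2%N by rewrite -(cardsC [set a]) bC !cards1.
have -> : independence_number G = 1%N.
  apply/eqP; rewrite eqn_leq; apply/andP; split.
    apply/bigmax_leqP => S indS; rewrite leqNgt; apply/negP => S2.
    have /eqP ST : S == setT by rewrite eqEcard subsetT cardsT nG.
    move/forall_inP: indS => /(_ a); rewrite ST inE => /(_ isT).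
    by move/forall_inP/(_ b); rewrite inE adjab => /(_ isT).
  rewrite -(cards1 a); apply: leq_bigmax_cond.
  apply/forall_inP => u /set1P->; apply/forall_inP => v /set1P->.
  by rewrite adj_irr.
rewrite (count_eq0_bipartite R G [set a]) //.
- by rewrite nG subrr divff ?subrr // pnatr_eq0.
- by rewrite bC !cards1.
by move=> u v; rewrite !inE => /eqP->; case: (all_ab v) => ->; rewrite ?eqxx.
Qed.
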